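(* Let $G$ be a finite non-abelian group, let $H$ be a non-trivial subgroup of $G$ with $H \neq Z(H,G)$, and let $g \in K(H,G)$. Let $|E(\Gamma_{H,G}^g)|$ denote the number of edges of $\Gamma_{H,G}^g$. Then: (a) If $g = 1$, then $$2|E(\Gamma_{H,G}^g)| = 2|H||G|\left(1 - \mathrm{Pr}_g(H,G)\right) - |H|^2\left(1 - \mathrm{Pr}_g(H)\right).$$ (b) If $g \neq 1$ and $g^2 = 1$, then $$2|E(\Gamma_{H,G}^g)| = \begin{cases} 2|H||G|\left(1 - \mathrm{Pr}_g(H,G)\right) - |H|^2\left(1 - \mathrm{Pr}_g(H)\right) - |H|, & \text{if } g \in H,\\ 2|H||G|\left(1 - \mathrm{Pr}_g(H,G)\right) - |H|^2 - |H|, & \text{if } g \in G\setminus H.\end{cases}$$ (c) If $g \neq 1$ and $g^2 \neq 1$, then $$2|E(\Gamma_{H,G}^g)| = \begin{cases} 2|H||G|\left(1 - \sum_{u = g, g^{-1}} \mathrm{Pr}_u(H,G)\right) - |H|^2\left(1 - \sum_{u = g,g^{-1}} \mathrm{Pr}_u(H)\right) - |H|, & \text{if } g \in H,\\ 2|H||G|\left(1 - \sum_{u = g,g^{-1}} \mathrm{Pr}_u(H,G)\right) - |H|^2 - |H|, & \text{if } g \in G \setminus H.\end{cases}$$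
   Context: For $x,y$ in a group, $[x,y] = x^{-1}y^{-1}xy$. For a subgroup $H$ of $G$: $Z(H,G) = \{x \in H : xy = yx \text{ for all } y \in G\}$ and $K(H,G) = \{[x,y] : x \in H,\ y \in G\}$. The relative $g$-noncommuting graph $\Gamma_{H,G}^g$ is the simple undirected graph with vertex set $G$ in which two distinct vertices $x,y$ are adjacent if and only if ($x \in H$ or $y \in H$) and $[x,y] \neq g$ and $[x,y] \neq g^{-1}$. For an element $u$, $\mathrm{Pr}_u(H,G) = \frac{|\{(x,y) \in H\times G : [x,y] = u\}|}{|H||G|}$ and $\mathrm{Pr}_u(H) = \mathrm{Pr}_u(H,H) = \frac{|\{(x,y)\in H\times H : [x,y]=u\}|}{|H|^2}$. *)

(* Defs.v *)
From mathcomp Require Import all_boot all_order all_algebra all_fingroup.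

Set Implicit Arguments.
Unset Strict Implicit.
Unset Printing Implicit Defensive.

Local Open Scope group_scope.

(* Adjacency of the relative g-noncommuting graph of G with respect to H; the
   vertex set is the subset G of gT, so membership in G is not part of the
   relation and is imposed in [edge_set]. *)
Definition rel_gnoncomm_adj (gT : finGroupType) (H : {set gT}) (g : gT) :
  rel gT :=
  fun x y =>
    [&& x != y, (x \in H) || (y \in H), [~ x, y] != g & [~ x, y] != g^-1].

(* Undirected edges are the unordered pairs {x, y} of adjacent vertices. *)
Definition edge_set (T : finType) (V : {set T}) (adj : rel T) : {set {set T}} :=
  [set [set x; y] | x in V, y in V & adj x y].

Definition rel_gnoncomm_edges (gT : finGroupType) (H G : {set gT}) (g : gT) :
  {set {set gT}} :=
  edge_set G (rel_gnoncomm_adj H g).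

(* Pr_u(H, G); the one-subgroup Pr_u(H) is Pr_comm u H H. *)
Definition Pr_comm (gT : finGroupType) (u : gT) (H G : {set gT}) : rat :=
  (#|[set p in setX H G | [~ p.1, p.2] == u]|%:R / (#|H|%:R * #|G|%:R))%R.

(* Main.v *)
Require Import Defs.
From mathcomp Require Import all_boot all_order all_algebra all_fingroup.
From mathcomp Require Import lra.

(** Twice the number of edges is the number of ordered pairs [(x, y)] of
    adjacent vertices ([card_edge_set]), so everything reduces to counting
    ordered pairs.

    Forget first the condition [x != y].  The pairs with [[~ x, y]] outside
    [{g, g^-1}] and at least one entry in [H] form the union of those lying in
    [H * G] and those lying in [G * H].  Since [[~ y, x] = [~ x, y]^-1] and
    [{g, g^-1}] is stable under inversion, swapping the entries exchanges the
    two sets; as [H] is contained in [G], they meet in the pairs lying in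
    [H * H].  Inclusion-exclusion gives twice the count over [H * G] minus the
    count over [H * H], and each count is the size of the product times the
    probability that a commutator avoids [g] and [g^-1] ([card_comm_notin]).

    Restoring [x != y] removes the diagonal pairs [(x, x)] with [x] in [H] whose
    commutator, [1], is outside [{g, g^-1}]: all [#|H|] of them if [g != 1], and
    none if [g = 1].  This is [card_rel_gnoncomm_edges]; the cases of the
    theorem then depend on whether [g] is [1], whether [g] and [g^-1] coincide,
    and whether [g] can be a commutator of elements of [H] at all. *)

Set Implicit Arguments.
Unset Strict Implicit.
Unset Printing Implicit Defensive.

Import GRing.Theory Num.Theory.

Local Open Scope ring_scope.

(** The map [(x, y) |-> [set x; y]] from adjacent ordered pairs onto edges is
    two-to-one: symmetry puts [(y, x)] in the fibre of [(x, y)], and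
    irreflexivity makes it a different pair. *)
Lemma card_edge_set (T : finType) (V : {set T}) (adj : rel T) :
    symmetric adj -> irreflexive adj ->
  (2 * #|edge_set V adj|)%N = #|[set p in setX V V | adj p.1 p.2]|.
Proof.
move=> adjC adjxx; set D := [set p in _ | _].
pose f (p : T * T) := [set p.1; p.2].
have ->: edge_set V adj = f @: D.
  apply/setP=> e; apply/imset2P/imsetP.
    case=> x y xV; rewrite inE => /andP[yV xy] ->.
    by exists (x, y) => //; rewrite !inE xV yV.
  case=> -[x y]; rewrite !inE => /andP[/andP[/= xV yV] xy] ->.
  by exists x y => //; rewrite inE yV.
rewrite -[RHS]sum1_card (partition_big_imset f) /=.
rewrite mulnC -sum_nat_const; apply: eq_bigr => _ /imsetP[[x y] Dxy ->].
have neq_xy : x != y.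
  by apply: contraL Dxy => /eqP->; rewrite inE /= adjxx andbF.
have Dyx : (y, x) \in D by move: Dxy; rewrite !inE /= adjC [(y \in V) && _]andbC.
rewrite sum1_card.
have /eq_card-> : [pred p in D | f p == f (x, y)] =i [set (x, y); (y, x)].
  move=> [a b]; rewrite inE /= in_set2 !xpair_eqE /f /=; apply/andP/orP; last first.
    by case=> /andP[/eqP-> /eqP->]; split; rewrite // setUC.
  case=> Dab /eqP eq_ab.
  have neq_ab : a != b.
    by apply: contraL Dab => /eqP->; rewrite inE /= adjxx andbF.
  have := set21 a b; have := set22 a b; rewrite eq_ab !inE.
  move=> /orP[] /eqP def_b /orP[] /eqP def_a; move: neq_ab; subst a b;
    by rewrite ?eqxx; auto.
by rewrite cards2 xpair_eqE (negPf neq_xy).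
Qed.

(** The fibres of the commutator map over the distinct elements of [s] are
    disjoint, and their sizes are the numerators of the probabilities. *)
Lemma card_comm_notin (gT : finGroupType) (A B : {set gT}) (s : seq gT) :
    uniq s ->
  #|[set p in setX A B | [~ p.1, p.2]%g \notin s]|%:R =
  #|A|%:R * #|B|%:R * (1 - \sum_(u <- s) Pr_comm u A B) :> rat.
Proof.
move=> Us; have [AB0 | AB_neq0] := eqVneq (#|A| * #|B|)%N 0.
  have /eqP X0 : setX A B == set0 by rewrite -cards_eq0 cardsX AB0.
  rewrite -natrM AB0 mul0r X0 (_ : [set p in _ | _] = set0) ?cards0 //.
  by apply/setP=> p; rewrite !inE.
(* An empty [A * B] was set aside so that the denominators below cancel. *)
have in_s : (\sum_(u <- s) #|[set p in setX A B | [~ p.1, p.2]%g == u]|)%N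
          = #|[set p in setX A B | [~ p.1, p.2]%g \in s]|.
  elim: s Us => [_|u s IHs /= /andP[uNs Us]].
    by rewrite big_nil; apply/esym/eq_card0 => p; rewrite !inE andbF.
  rewrite big_cons IHs // -cardsUI [X in (_ + X)%N]eq_card0 ?addn0.
    by apply: eq_card => p; rewrite !inE -andb_orr.
  move=> p; rewrite !inE; apply/negP=> /andP[/andP[_ /eqP->]].
  by rewrite (negPf uNs) andbF.
have cardX : (#|[set p in setX A B | [~ p.1, p.2]%g \in s]|
            + #|[set p in setX A B | [~ p.1, p.2]%g \notin s]|)%N
           = (#|A| * #|B|)%N.
  rewrite -cardsX -(cardsID [set p | [~ p.1, p.2]%g \in s] (setX A B)).
  by congr (_ + _)%N; apply: eq_card => p; rewrite !inE // andbC.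
rewrite /Pr_comm -mulr_suml -natr_sum in_s -!natrM mulrBr mulr1.
by rewrite [X in _ - X]mulrC divfK ?pnatr_eq0 // -cardX natrD addrC addKr.
Qed.

(** Inclusion-exclusion on the ordered pairs, followed by removal of the
    diagonal.  Listing the forbidden commutators without duplicates treats the
    cases [g^-1 = g] and [g^-1 != g] at once. *)
Lemma card_rel_gnoncomm_edges (gT : finGroupType) (G H : {group gT}) (g : gT) :
    H \subset G ->
  let s := undup [:: g; g^-1%g] in
  2%:R * #|rel_gnoncomm_edges H G g|%:R =
  2%:R * #|H|%:R * #|G|%:R * (1 - \sum_(u <- s) Pr_comm u H G)
  - #|H|%:R ^+ 2 * (1 - \sum_(u <- s) Pr_comm u H H)
  - #|H|%:R *+ (g != 1%g) :> rat.
Proof.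
move=> sHG s; have Us : uniq s by apply: undup_uniq.
have sE z : (z \notin s) = (z != g) && (z != g^-1%g).
  by rewrite mem_undup !inE negb_or.
have sV z : (z^-1%g \notin s) = (z \notin s).
  by rewrite !sE (inv_eq invgK) (inj_eq invg_inj) andbC.
have sC x y : ([~ y, x]%g \notin s) = ([~ x, y]%g \notin s).
  by rewrite -invg_comm sV.
have s1 : (1%g \notin s) = (g != 1%g).
  by rewrite sE ![1%g == _]eq_sym invg_eq1 andbb.
have adjC : symmetric (rel_gnoncomm_adj H g).
  by move=> x y; rewrite /rel_gnoncomm_adj -!sE eq_sym orbC sC.
have adjxx : irreflexive (rel_gnoncomm_adj H g).
  by move=> x; rewrite /rel_gnoncomm_adj eqxx.
pose N A B := [set p in setX A B | [~ p.1, p.2]%g \notin s].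
have cardN_swap : #|N G H| = #|N H G|.
  have swap_inj : injective (fun p : gT * gT => (p.2, p.1)).
    by move=> [a b] [c d] [-> ->].
  rewrite -(card_imset _ swap_inj); apply: eq_card => -[x y].
  apply/imsetP/idP.
    by case=> -[a b]; rewrite !inE /= => /andP[/andP[aG bH] ab] [-> ->];
       rewrite sC ab aG bH.
  rewrite !inE /= => /andP[/andP[xH yG] xy]; exists (y, x) => //.
  by rewrite !inE /= sC xy xH yG.
have NI : N H G :&: N G H = N H H.
  apply/setP=> -[x y]; rewrite !inE /=; have := subsetP sHG.
  move=> sub; apply/idP/idP.
    by case/andP=> /andP[/andP[-> _] ->] /andP[/andP[_ ->] _].
  by case/andP=> /andP[xH yH] ->; rewrite xH yH !sub.
pose D := [set p : gT * gT | p.1 == p.2].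
have card_diag : #|(N H G :|: N G H) :&: D| = (#|H| * (g != 1%g))%N.
  case: (boolP (g != 1%g)) => g1; last first.
    rewrite muln0; apply: eq_card0 => -[x y]; rewrite !inE /=.
    by apply/negP=> /andP[Nxy /eqP eq_xy]; move: Nxy;
       rewrite eq_xy commgg s1 (negPf g1) !andbF.
  have diag_inj : injective (fun x : gT => (x, x)) by move=> x y [].
  rewrite muln1 -(card_imset _ diag_inj); apply: eq_card => -[x y].
  rewrite !inE /=; apply/andP/imsetP.
    case=> Nxy /eqP eq_xy; exists x; last by rewrite eq_xy.
    by move: Nxy; rewrite -eq_xy => /orP[] /andP[/andP[xH xG] _].
  case=> z zH [-> ->]; split=> //.
  by rewrite commgg s1 g1 zH (subsetP sHG).
have cardE : (2 * #|rel_gnoncomm_edges H G g| + #|H| * (g != 1%g) + #|N H H|)%N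
           = (2 * #|N H G|)%N.
  rewrite card_edge_set // -card_diag -NI mul2n -addnn -{2}cardN_swap -cardsUI.
  congr (_ + _)%N; rewrite addnC -(cardsID D (N H G :|: N G H)); congr (_ + _)%N.
  apply: eq_card => -[x y]; rewrite !inE /rel_gnoncomm_adj /= -sE.
  move: (subsetP sHG x) (subsetP sHG y).
  case: (x \in H) => [->|_] //; case: (y \in H) => [->|_] //;
    by case: (x == y); rewrite /= ?andbT ?andbF ?orbF ?orbb.
have {cardE} : 2%:R * #|rel_gnoncomm_edges H G g|%:R + #|H|%:R * (g != 1%g)%:R
    + #|N H H|%:R = 2%:R * #|N H G|%:R :> rat by rewrite -!natrM -!natrD cardE.
rewrite !card_comm_notin // mulr_natr; lra.
Qed.

(** This is why no term in [Pr_comm g H H] appears when [g] is outside [H]: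
    a subgroup contains the commutators of its elements. *)
Lemma Pr_comm_notin (gT : finGroupType) (H : {group gT}) (u : gT) :
  u \notin H -> Pr_comm u H H = 0.
Proof.
move=> uNH; rewrite /Pr_comm [#|_|]eq_card0 ?mul0r // => -[x y].
rewrite !inE /=; apply/negP=> /andP[/andP[xH yH] /eqP def_u].
by rewrite -def_u groupR in uNH.
Qed.

Theorem theorem3p1 (gT : finGroupType) (G H : {group gT}) (g : gT)
  (nabG : ~~ abelian G)
  (sHG : H \subset G)
  (ntH : (H :!=: 1)%g)
  (HneqZ : (H :!=: 'C_H(G))%g)
  (gK : g \in commg_set H G) :
  let E2 : rat := 2%:R * #|rel_gnoncomm_edges H G g|%:R in
  let h : rat := #|H|%:R in
  let n : rat := #|G|%:R in
  [/\ g = 1%g ->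
        E2 = 2%:R * h * n * (1 - Pr_comm g H G)
             - h ^+ 2 * (1 - Pr_comm g H H),
      g <> 1%g -> (g ^+ 2)%g = 1%g ->
        (g \in H ->
           E2 = 2%:R * h * n * (1 - Pr_comm g H G)
                - h ^+ 2 * (1 - Pr_comm g H H) - h)
        /\ (g \in G :\: H ->
           E2 = 2%:R * h * n * (1 - Pr_comm g H G) - h ^+ 2 - h)
    & g <> 1%g -> (g ^+ 2)%g <> 1%g ->
        (g \in H ->
           E2 = 2%:R * h * n * (1 - \sum_(u <- [:: g; g^-1%g]) Pr_comm u H G)
                - h ^+ 2 * (1 - \sum_(u <- [:: g; g^-1%g]) Pr_comm u H H) - h)
        /\ (g \in G :\: H ->
           E2 = 2%:R * h * n * (1 - \sum_(u <- [:: g; g^-1%g]) Pr_comm u H G)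
                - h ^+ 2 - h)].
Proof.
move=> E2 h n; have := card_rel_gnoncomm_edges g sHG.
rewrite /= -/E2 -/h -/n inE => edges.
have sumHH0 (s : seq gT) : {in s, forall u, u \notin H} ->
    \sum_(u <- s) Pr_comm u H H = 0.
  by move=> sNH; rewrite big_seq big1 // => u /sNH/Pr_comm_notin.
have eq_gV : (g == g^-1%g) = (g ^+ 2 == 1)%g.
  by rewrite expgS expg1 eq_sym eq_invg_mul.
split=> [g1 | /eqP g1 gg | /eqP g1 /eqP gg]; move: edges.
- by rewrite g1 invg1 !eqxx !big_seq1 subr0.
- have gV : g^-1%g = g by apply/esym/eqP; rewrite eq_gV gg.
  rewrite gV eqxx g1 !big_seq1 mulr1n => ->.
  split=> //; rewrite inE => /andP[gNH _].
  by rewrite Pr_comm_notin // subr0 mulr1.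
- rewrite eq_gV (negPf gg) g1 mulr1n => ->.
  split=> //; rewrite inE => /andP[gNH _].
  rewrite sumHH0 ?subr0 ?mulr1 // => u.
  by rewrite !inE => /orP[] /eqP->; rewrite ?groupV.
Qed.
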